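(* Let $f:\mathbb{R}^n\to\mathbb{R}$ be differentiable with $L_f$-Lipschitz continuous gradient, $L_f>0$, and set $\mu=1/L_f$. Let $g:\mathbb{R}^n\to\mathbb{R}\cup\{+\infty\}$ be proper, lower semi-continuous and convex. Let $C\in\mathbb{R}^{m\times n}$ have full row rank, $\mathrm{rank}(C)=m$, let $d\in\mathbb{R}^m$, and let $\mathcal{C}=\{x\in\mathbb{R}^n: Cx+d=0\}$. Put $\bar g=g+\iota_{\mathcal{C}}$ and $\bar F=f+\bar g=f+g+\iota_{\mathcal{C}}$. Assume that the proximal operator of $g$ is compatible with the equality constraint, i.e. $$\mathcal{P}_{\mathcal{C}}\big(\mathrm{prox}_{\mu g}(w)\big)=\mathrm{prox}_{\mu\bar g}(w)\qquad\text{for all } w\in\mathbb{R}^n,$$ where $\mathcal{P}_{\mathcal{C}}$ is the orthogonal projection onto $\mathcal{C}$. Assume that $\bar F$ satisfies the proximal Polyak--\L{}ojasiewicz condition with $\mu=1/L_f$ and constant $\alpha\in(0,L_f)$. Let $K,L\in\mathbb{R}^{m\times m}$ be such that $N=\begin{bmatrix}0&I\\L&K\end{bmatrix}$ satisfies $NQN^\top-(1-r_e)Q\prec0$ for some $Q=Q^\top\succ0$ and some $r_e\in(0,1)$. Then the set of optimal solutions of $$\min_{x\in\mathbb{R}^n} f(x)+g(x)\quad\text{subject to}\quad Cx+d=0$$ is globally exponentially stable for the dynamics $$\begin{aligned}x^+&=\Pi(x)-C^\top(CC^\top)^{-1}\big(C\,\Pi(x)+d-v\big),\\ v^+&=Kv+L(Cx+d),\end{aligned}\qquad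 \Pi(x)=\mathrm{prox}_{\mu g}\big(x-\mu\nabla f(x)\big).$$
   Context: Proximal operator: $\mathrm{prox}_{\mu g}(v)=\arg\min_{x\in\mathbb{R}^n}\big(g(x)+\frac{1}{2\mu}\|x-v\|_2^2\big)$, and likewise for $\bar g$. Indicator function: $\iota_{\mathcal{C}}(x)=0$ if $x\in\mathcal{C}$ and $+\infty$ otherwise. The superscript $+$ denotes the forward time shift (next value of the signal). Proximal Polyak--\L{}ojasiewicz condition for $\bar F=f+\bar g$ with parameter $\mu>0$ and constant $\alpha>0$: $\bar F$ attains its minimum value $F^\star=\min_{x\in\mathbb{R}^n}\bar F(x)$ and, for all $x$, $$\tfrac12 D_{\bar g}(x,\mu)\ge\alpha\big(\bar F(x)-F^\star\big),$$ $$D_{\bar g}(x,\mu)=-\frac{2}{\mu}\min_{y\in\mathbb{R}^n}\Big\{\langle\nabla f(x),y-x\rangle+\frac{1}{2\mu}\|y-x\|_2^2+\bar g(y)-\bar g(x)\Big\}.$$ (For $x$ with $\bar g(x)=+\infty$ both sides are understood as $+\infty$, so the condition is a requirement on points with $\bar g(x)<+\infty$.) The set $X^\star=\{x:\bar F(x)=F^\star\}$ is the set of optimal solutions of the constrained problem. Its global exponential stability for the dynamics with state $(x,v)\in\mathbb{R}^n\times\mathbb{R}^m$ means that of the set $X^\star\times\{0\}$: there exist $\kappa>0$ and $r\in(0,1)$ such that for every initial condition $(x_0,v_0)$ and all $k\in\mathbb{N}$, $\mathrm{dist}\big((x_k,v_k),X^\star\times\{0\}\big)\le\kappa\,r^k\,\mathrm{dist}\big((x_0,v_0),X^\star\times\{0\}\big)$,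 with the Euclidean distance. *)

(* Defs.v *)
(* MathComp-Analysis. Vectors of R^n are columns 'cV[R]_n. *)
From HB Require Import structures.
From mathcomp Require Export all_boot all_order all_algebra.
From mathcomp Require Export all_classical all_reals all_analysis.
Export Order.TTheory GRing.Theory Num.Theory.
Export numFieldNormedType.Exports.

Set Implicit Arguments.
Unset Strict Implicit.
Unset Printing Implicit Defensive.

Local Open Scope classical_set_scope.
Local Open Scope ring_scope.

(* The library norm `|x| on matrices is the sup norm, hence [enorm]; both induce
   the same topology, so [differentiable] and [lower_semicontinuous] are used
   unchanged. *)
Definition dotv (R : realType) (n : nat) (x y : 'cV[R]_n) : R :=
  \sum_(i < n) x i 0 * y i 0.

Definition enorm (R : realType) (n : nat) (x : 'cV[R]_n) : R :=
  Num.sqrt (dotv x x).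

(* Junk value when f is not differentiable at x. *)
Definition grad (R : realType) (n : nat) (f : 'cV[R]_n -> R) (x : 'cV[R]_n) :
    'cV[R]_n :=
  \col_(i < n) 'D_(delta_mx i 0) f x.

Definition lipschitz_grad (R : realType) (n : nat) (f : 'cV[R]_n -> R)
    (Lf : R) : Prop :=
  forall x y, enorm (grad f x - grad f y) <= Lf * enorm (x - y).

Definition proper (R : realType) (n : nat) (g : 'cV[R]_n -> \bar R) : Prop :=
  (forall x, g x != -oo%E) /\ (exists x, (g x < +oo)%E).

(* For g > -oo the right-hand side is well defined, with 0 * +oo = 0. *)
Definition econvex (R : realType) (n : nat) (g : 'cV[R]_n -> \bar R) : Prop :=
  forall (x y : 'cV[R]_n) (t : R), 0 <= t <= 1 ->
    (g (t *: x + (1 - t) *: y)%R <= t%:E * g x + (1 - t)%:E * g y)%E.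

Definition indic0 (R : realType) (n : nat) (S : set 'cV[R]_n) (x : 'cV[R]_n) :
    \bar R :=
  if x \in S then 0%E else +oo%E.

(* Default value 0 when there is no minimizer; for proper, lower semi-continuous
   convex g and mu > 0 the minimizer exists and is unique. *)
Definition prox (R : realType) (n : nat) (mu : R) (g : 'cV[R]_n -> \bar R)
    (v : 'cV[R]_n) : 'cV[R]_n :=
  let phi x := (g x + ((2 * mu)^-1 * enorm (x - v) ^+ 2)%:E)%E in
  xget 0 [set x | forall y, (phi x <= phi y)%E].

(* Default value 0 when there is no nearest point; for nonempty closed convex S
   the nearest point exists and is unique. *)
Definition proj (R : realType) (n : nat) (S : set 'cV[R]_n) (w : 'cV[R]_n) :
    'cV[R]_n :=
  xget 0 [set p | S p /\ forall q, S q -> enorm (w - p) <= enorm (w - q)].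

Definition affine_set (R : realType) (m n : nat) (C : 'M[R]_(m, n))
    (d : 'cV[R]_m) : set 'cV[R]_n :=
  [set x | C *m x + d = 0].

Definition gbar (R : realType) (m n : nat) (g : 'cV[R]_n -> \bar R)
    (C : 'M[R]_(m, n)) (d : 'cV[R]_m) (x : 'cV[R]_n) : \bar R :=
  (g x + indic0 (affine_set C d) x)%E.

Definition objective (R : realType) (n : nat) (f : 'cV[R]_n -> R)
    (h : 'cV[R]_n -> \bar R) (x : 'cV[R]_n) : \bar R :=
  ((f x)%:E + h x)%E.

Definition infval (R : realType) (n : nat) (F : 'cV[R]_n -> \bar R) : \bar R :=
  ereal_inf (range F).

(* Meaningful when h x is finite. The infimum is a minimum if moreover h is
   proper, lower semi-continuous and convex and mu > 0, the bracket then being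
   strongly convex in y. *)
Definition prox_gap (R : realType) (n : nat) (f : 'cV[R]_n -> R)
    (h : 'cV[R]_n -> \bar R) (x : 'cV[R]_n) (mu : R) : \bar R :=
  (- (2 / mu)%:E * ereal_inf (range (fun y : 'cV[R]_n =>
    (dotv (grad f x) (y - x) + (2 * mu)^-1 * enorm (y - x) ^+ 2)%:E
      + (h y - h x))))%E.

(* The minimum of F = f + h is attained with a real value, and the inequality is
   required where h is finite. *)
Definition prox_PL (R : realType) (n : nat) (f : 'cV[R]_n -> R)
    (h : 'cV[R]_n -> \bar R) (mu alpha : R) : Prop :=
  let F := objective f h in
  [/\ infval F \is a fin_num,
      exists xs, F xs = infval F &
      forall x, (h x < +oo)%E ->
        ((1 / 2)%:E * prox_gap f h x mu >= alpha%:E * (F x - infval F))%E].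

Definition opt_set (R : realType) (n : nat) (F : 'cV[R]_n -> \bar R) :
    set 'cV[R]_n :=
  [set x | F x = infval F].

Definition posdefmx (R : realType) (p : nat) (M : 'M[R]_p) : Prop :=
  forall z : 'cV[R]_p, z != 0 -> 0 < (z^T *m M *m z) 0 0.

Definition negdefmx (R : realType) (p : nat) (M : 'M[R]_p) : Prop :=
  forall z : 'cV[R]_p, z != 0 -> (z^T *m M *m z) 0 0 < 0.

(* Euclidean distance on R^n x R^m from z to a nonempty set A. *)
Definition edist2 (R : realType) (n m : nat) (z : 'cV[R]_n * 'cV[R]_m)
    (A : set ('cV[R]_n * 'cV[R]_m)) : R :=
  inf [set Num.sqrt (enorm (z.1 - a.1) ^+ 2 + enorm (z.2 - a.2) ^+ 2) | a in A].

Definition glob_exp_stable (R : realType) (n m : nat)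
    (T : 'cV[R]_n * 'cV[R]_m -> 'cV[R]_n * 'cV[R]_m)
    (A : set ('cV[R]_n * 'cV[R]_m)) : Prop :=
  exists kappa r : R, [/\ 0 < kappa, 0 < r < 1 &
    forall (z0 : 'cV[R]_n * 'cV[R]_m) (k : nat),
      edist2 (iter k T z0) A <= kappa * r ^+ k * edist2 z0 A].

Definition prox_grad (R : realType) (n : nat) (f : 'cV[R]_n -> R)
    (g : 'cV[R]_n -> \bar R) (mu : R) (x : 'cV[R]_n) : 'cV[R]_n :=
  prox mu g (x - mu *: grad f x).

Definition dynamics (R : realType) (m n : nat) (f : 'cV[R]_n -> R)
    (g : 'cV[R]_n -> \bar R) (C : 'M[R]_(m, n)) (d : 'cV[R]_m)
    (K L : 'M[R]_m) (mu : R) (z : 'cV[R]_n * 'cV[R]_m) :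
    'cV[R]_n * 'cV[R]_m :=
  let: (x, v) := z in
  let Px := prox_grad f g mu x in
  (Px - C^T *m invmx (C *m C^T) *m (C *m Px + d - v),
   K *m v + L *m (C *m x + d)).

(* Main.v *)
Require Import Defs.
From mathcomp Require Import ring lra.

(** Writing Cp for the right inverse C^T (C C^T)^-1 of C, the orthogonal
    projection onto the affine set is y(x) = x - Cp (C x + d). By the
    compatibility hypothesis, one step of the dynamics is
    x+ = T x + Cp v, where T is the proximal gradient map of the constrained
    problem, min f + gbar. Two facts follow: y(x+) = T x, and the constraint
    error e = C x + d obeys (e, v)+ = N (e, v), independently of f and g. The
    system is thus a proximal gradient iteration on the feasible point y(x),
    whose base point is displaced by x - y(x) = Cp e, with e driven by a stable
    linear system.

    The linear part has the Lyapunov function V = z^T Q^-1 z. The hypothesis on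
    N Q N^T says that the transpose of N contracts the norm of Q, and by duality
    N contracts the norm of Q^-1 ([lyap_decay]).

    For the nonlinear part let E be the excess of f + gbar over its minimum. The
    descent lemma and the PL condition give E(T y) <= (1 - alpha / Lf) E(y), and
    a displacement u of the base point costs at most a fraction of E(y), small
    enough to preserve the contraction, plus a multiple of |u|^2
    ([subopt_prox_grad_perturbed]). The sum W = E(y(x)) + beta V(e, v), with beta
    large, therefore decreases by a constant factor at each step.

    It remains to compare W with the squared distance to the solution set. In
    one direction this is quadratic growth ([quadratic_growth]): the proximal
    gradient iterates started at y have geometrically decaying steps, hence
    converge to a solution at a distance at most a multiple of sqrt(E(y)). In the
    other direction E(y(x)) may be infinite at the initial point, but after one
    step E(T x) <= 2 Lf |x - xs|^2 for every solution xs
    ([subopt_prox_grad_dist]). This is enough for exponential stability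
    ([lyapunov_exp_stable]).

    The proximal points of gbar have to be shown to exist
    ([penalized_min_exists]); they enter through the fact that T x minimizes the
    linearization of f at x plus gbar plus a quadratic penalty. *)

Set Implicit Arguments.
Unset Strict Implicit.
Unset Printing Implicit Defensive.

Local Open Scope classical_set_scope.
Local Open Scope ring_scope.

(** * The Euclidean inner product on column vectors *)

Section Euclidean.
Variable R : realType.

Section OneSpace.
Variable n : nat.
Implicit Types (x y z : 'cV[R]_n) (a : R).

Lemma dotvE x y : dotv x y = (x^T *m y) 0 0.
Proof. by rewrite mxE; apply: eq_bigr => i _; rewrite mxE. Qed.

Lemma dotvC x y : dotv x y = dotv y x.
Proof. by apply: eq_bigr => i _; rewrite mulrC. Qed.

Lemma dotvDl x y z : dotv (x + y) z = dotv x z + dotv y z.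
Proof. by rewrite -big_split; apply: eq_bigr => i _; rewrite mxE mulrDl. Qed.

Lemma dotvZl a x y : dotv (a *: x) y = a * dotv x y.
Proof. by rewrite mulr_sumr; apply: eq_bigr => i _; rewrite mxE mulrA. Qed.

Lemma dotvNl x y : dotv (- x) y = - dotv x y.
Proof. by rewrite -scaleN1r dotvZl mulN1r. Qed.

Lemma dotvDr x y z : dotv x (y + z) = dotv x y + dotv x z.
Proof. by rewrite dotvC dotvDl !(dotvC x). Qed.

Lemma dotvZr a x y : dotv x (a *: y) = a * dotv x y.
Proof. by rewrite dotvC dotvZl dotvC. Qed.

Lemma dotvNr x y : dotv x (- y) = - dotv x y.
Proof. by rewrite dotvC dotvNl dotvC. Qed.

Lemma dotv0l y : dotv 0 y = 0.
Proof. by rewrite -(scale0r 0) dotvZl mul0r. Qed.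

Definition dotv_lin := (dotvDl, dotvDr, dotvNl, dotvNr, dotvZl, dotvZr).

Lemma dotv_ge0 x : 0 <= dotv x x.
Proof. by apply: sumr_ge0 => i _; rewrite -expr2 sqr_ge0. Qed.

Lemma dotv_eq0 x : dotv x x = 0 -> x = 0.
Proof.
move/eqP; rewrite psumr_eq0 => [/allP x0|i _]; last by rewrite -expr2 sqr_ge0.
apply/colP => i; rewrite mxE; apply/eqP.
by have := x0 i (mem_index_enum _); rewrite mulf_eq0 orbb.
Qed.

Lemma sqr_enorm x : enorm x ^+ 2 = dotv x x.
Proof. by rewrite sqr_sqrtr // dotv_ge0. Qed.

Lemma enorm_ge0 x : 0 <= enorm x.
Proof. exact: sqrtr_ge0. Qed.

Lemma enorm_le x a : 0 <= a -> dotv x x <= a ^+ 2 -> enorm x <= a.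
Proof.
move=> a0 xa.
by rewrite -(ler_pXn2r (_ : 0 < 2)%N) ?nnegrE ?enorm_ge0// sqr_enorm.
Qed.

Lemma enorm0 : enorm (0 : 'cV[R]_n) = 0.
Proof. by rewrite /enorm dotv0l sqrtr0. Qed.

Lemma enormN x : enorm (- x) = enorm x.
Proof. by rewrite /enorm dotvNl dotvNr opprK. Qed.

Lemma enormB x y : enorm (x - y) = enorm (y - x).
Proof. by rewrite -opprB enormN. Qed.

Lemma enormZ a x : enorm (a *: x) = `|a| * enorm x.
Proof.
by rewrite /enorm dotvZl dotvZr mulrA -expr2 sqrtrM ?sqr_ge0// sqrtr_sqr.
Qed.

End OneSpace.

Lemma dotv_mulmx n p (A : 'M[R]_(p, n)) x y :
  dotv x (A *m y) = dotv (A^T *m x) y.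
Proof. by rewrite !dotvE trmx_mul trmxK mulmxA. Qed.

(** The quadratic form is nonnegative at the combination of x and y that makes
    its discriminant appear; when it vanishes at y the combination is sent to
    infinity along y instead. *)
Lemma psd_cauchy_schwarz p (M : 'M[R]_p) (x y : 'cV[R]_p) : M^T = M ->
  (forall z, 0 <= dotv z (M *m z)) ->
  dotv x (M *m y) ^+ 2 <= dotv x (M *m x) * dotv y (M *m y).
Proof.
move=> Msym Mpsd; have := Mpsd y; set a := dotv y _ => a0.
set b := dotv x _; set c := dotv x _.
have q s t : 0 <= s ^+ 2 * c + 2 * s * t * b + t ^+ 2 * a.
  have := Mpsd (s *: x + t *: y).
  rewrite !mulmxDr -!scalemxAr !dotv_lin -/a -/b -/c.
  rewrite (_ : dotv y (M *m x) = b); last by rewrite dotv_mulmx Msym dotvC.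
  by congr (_ <= _); ring.
have [a_eq0|a_neq0] := eqVneq a 0; last first.
  have a_gt0 : 0 < a by rewrite lt_neqAle eq_sym a_neq0.
  by have := q a (- b); nra.
have [->|b0] := eqVneq b 0; first by rewrite a_eq0 mulr0 expr0n.
have := q 1 (- (c + 1) / (2 * b)).
suff -> : 1 ^+ 2 * c + 2 * 1 * (- (c + 1) / (2 * b)) * b +
    (- (c + 1) / (2 * b)) ^+ 2 * a = -1 by rewrite ler0N1.
by rewrite a_eq0; field.
Qed.

Section Norms.
Variable n : nat.
Implicit Types (x y z : 'cV[R]_n).

Lemma cauchy_schwarz x y : dotv x y <= enorm x * enorm y.
Proof.
have := @psd_cauchy_schwarz _ 1%:M x y (trmx1 _ _).
rewrite !mul1mx => /(_ _)-/(_ _) => cs.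
have {}cs : dotv x y ^+ 2 <= (enorm x * enorm y) ^+ 2.
  by rewrite exprMn !sqr_enorm; apply: cs => z; rewrite mul1mx dotv_ge0.
have [xy0|/ltW xy0] := lerP (dotv x y) 0.
  by apply: le_trans xy0 _; rewrite mulr_ge0 ?enorm_ge0.
by rewrite -(ler_pXn2r (_ : 0 < 2)%N) ?nnegrE ?mulr_ge0 ?enorm_ge0.
Qed.

Lemma enormD x y : enorm (x + y) <= enorm x + enorm y.
Proof.
apply: enorm_le; first by rewrite addr_ge0 ?enorm_ge0.
rewrite !dotv_lin (dotvC y x) sqrrD !sqr_enorm.
by have := cauchy_schwarz x y; lra.
Qed.

Lemma sqr_enormD_le x y :
  enorm (x + y) ^+ 2 <= 2 * enorm x ^+ 2 + 2 * enorm y ^+ 2.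
Proof.
rewrite !sqr_enorm; have := dotv_ge0 (x - y).
by rewrite !dotv_lin (dotvC y x); lra.
Qed.

Lemma coord_le_enorm x i : `|x i 0| <= enorm x.
Proof.
rewrite -sqrtr_sqr ler_sqrt ?dotv_ge0// /dotv (bigD1 i)//= -expr2 lerDl.
by apply: sumr_ge0 => j _; rewrite -expr2 sqr_ge0.
Qed.

Lemma norm_le_enorm x : `|x| <= enorm x.
Proof.
rewrite [`|x|]mx_normrE; apply/bigmax_leP; split; first exact: enorm_ge0.
by move=> [i j] _ /=; rewrite ord1 coord_le_enorm.
Qed.

Lemma enorm_continuous : continuous (@enorm R n).
Proof.
move=> x; apply: (@continuous_comp _ _ _ (fun y => dotv y y)); last first.
  exact: sqrt_continuous.
apply: continuous_big => [|i _ {}x]; first exact: add_continuous.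
have ci := @coord_continuous R n 1 i 0 x.
exact: (continuousM ci ci).
Qed.

End Norms.

Lemma mulmx_bounded n p (A : 'M[R]_(p, n)) :
  exists2 c, 0 < c & forall x, enorm (A *m x) ^+ 2 <= c * enorm x ^+ 2.
Proof.
exists (1 + \sum_i dotv (row i A)^T (row i A)^T).
  by rewrite ltr_wpDr// sumr_ge0// => i _; exact: dotv_ge0.
move=> x; rewrite mulrDl mul1r ler_wpDl ?sqr_ge0// sqr_enorm {1}/dotv mulr_suml.
apply: ler_sum => i _; rewrite -expr2.
have -> : (A *m x) i 0 = dotv (row i A)^T x.
  by rewrite mxE; apply: eq_bigr => j _; rewrite !mxE.
have := @psd_cauchy_schwarz _ 1%:M (row i A)^T x (trmx1 _ _).
rewrite !mul1mx sqr_enorm; apply => z; rewrite mul1mx; exact: dotv_ge0.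
Qed.

(** Completeness, in the form used below: increments that decay geometrically
    sum up, so the sequence converges and its limit stays at a distance from
    the starting point controlled by the first increment. *)
Lemma geometric_limit n (x : nat -> 'cV[R]_n) (c q : R) :
  0 <= q < 1 -> 0 <= c ->
  (forall k, enorm (x k.+1 - x k) <= c * q ^+ k) ->
  exists2 l : 'cV[R]_n, x @ \oo --> l & enorm (l - x 0) <= c / (1 - q).
Proof.
move=> /andP[q0 q1] c0 xq; have q1' : 0 < 1 - q by rewrite subr_gt0.
have tail k j :
    enorm (x (k + j)%N - x k) <= c / (1 - q) * (q ^+ k - q ^+ (k + j)).
  elim: j => [|j ih]; first by rewrite addn0 !subrr enorm0 mulr0.
  rewrite addnS -(subrKA (x (k + j)%N)).
  apply: le_trans (enormD _ _) _; apply: le_trans (lerD (xq _) ih) _.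
  rewrite le_eqVlt; apply/orP; left; apply/eqP; rewrite exprS.
  by field; rewrite gt_eqF.
have tail' k j : enorm (x (k + j)%N - x k) <= c / (1 - q) * q ^+ k.
  apply: le_trans (tail k j) _; rewrite ler_wpM2l ?divr_ge0 ?(ltW q1')//.
  by rewrite gerBl exprn_ge0.
have : cvgn x.
  apply/cauchy_cvgP; apply: cauchy_exP => e e0.
  have : (c / (1 - q) * q ^+ k) @[k --> \oo] --> (c / (1 - q) * 0).
    apply: cvgM; first exact: cvg_cst.
    by apply: cvg_expr; rewrite ger0_norm.
  rewrite mulr0 => /cvgr_lt /(_ _ e0) [K _ /(_ K (leqnn K)) /= Ke].
  exists (x K); exists K => // k /= Kk.
  rewrite -ball_normE /= -(subnKC Kk).
  apply: le_lt_trans (norm_le_enorm _) _; rewrite enormB.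
  exact: le_lt_trans (tail' _ _) Ke.
move=> xl; exists (limn x) => //.
have : enorm (x k - x 0) @[k --> \oo] --> enorm (limn x - x 0).
  apply: (continuous_cvg _ (@enorm_continuous n _)).
  by apply: cvgB => //; exact: cvg_cst.
apply: (closed_cvg (fun t => t <= c / (1 - q)) (@closed_le _ _)).
by apply: nearW => k; have := tail' 0 k; rewrite add0n expr0 mulr1; exact.
Qed.

End Euclidean.

(** * Functions with Lipschitz gradient *)

Section Smooth.
Variables (R : realType) (n : nat) (f : 'cV[R]_n -> R).
Hypothesis f_diff : forall x, differentiable f x.

Lemma derive_dotv_grad (x u : 'cV[R]_n) : 'D_u f x = dotv (grad f x) u.
Proof.
rewrite deriveE// {1}(matrix_sum_delta u) linear_sum; apply: eq_bigr => i _.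
by rewrite big_ord1 linearZ/= mxE deriveE// mulrC.
Qed.

Lemma is_derive_line (x u : 'cV[R]_n) (t : R) :
  is_derive t 1 (fun s : R => f (x + s *: u)) (dotv (grad f (x + t *: u)) u).
Proof.
have E : (fun h : R => h^-1 *: (((fun s => f (x + s *: u)) \o shift t) (h *: 1)
      - f (x + t *: u))) =
    (fun h => h^-1 *: ((f \o shift (x + t *: u)) (h *: u) - f (x + t *: u))).
  apply/funext => h /=; rewrite [h *: 1]mulr1.
  by rewrite scalerDl addrCA.
apply: DeriveDef; last by rewrite -derive_dotv_grad /derive E.
by rewrite /derivable E; exact: diff_derivable.
Qed.

(** The difference between f on the segment and its quadratic majorant is
    nonincreasing, because the gradient moves by at most Lf t |u| along it. *)
Lemma descent_lemma (Lf : R) (x y : 'cV[R]_n) : lipschitz_grad f Lf ->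
  f y <= f x + dotv (grad f x) (y - x) + Lf / 2 * enorm (y - x) ^+ 2.
Proof.
move=> fL; set u := y - x.
pose psi (t : R) : R := f (x + t *: u) - dotv (grad f x) u * t
  - Lf / 2 * enorm u ^+ 2 * t ^+ 2.
have dpsi (t : R) : is_derive t (1 : R) psi (dotv (grad f (x + t *: u)) u
    - dotv (grad f x) u - Lf * enorm u ^+ 2 * t).
  have H1 := is_deriveZ (dotv (grad f x) u) (is_derive_id t (1 : R)).
  have H2 := is_deriveZ (Lf / 2 * enorm u ^+ 2)
    (is_deriveX 2 (is_derive_id t (1 : R))).
  apply: is_derive_eq (is_deriveB (is_deriveB (is_derive_line x u t) H1) H2) _.
  rewrite !scaler1 /= expr1; congr (_ - _).
  by rewrite -[_ *: _]/(_ * _); field.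
have : psi 1 <= psi 0.
  apply: (@ler0_derive1_nincr R psi 0 1) => //.
  - move=> t; rewrite in_itv/= => /andP[t0 t1].
    rewrite derive1E (@derive_val _ _ _ _ _ _ _ (dpsi t)).
    rewrite -(dotvNl (grad f x)) -dotvDl.
    have := cauchy_schwarz (grad f (x + t *: u) - grad f x) u.
    have := fL (x + t *: u) x.
    rewrite [x + _ - x]addrC addKr enormZ gtr0_norm//.
    by have := enorm_ge0 u; nra.
  - by apply: derivable_within_continuous => t _.
rewrite /psi scale1r scale0r addr0 expr1n expr0n/= !mulr0 !mulr1 !subr0.
by rewrite [x + u]addrC subrK; lra.
Qed.

End Smooth.

(** * Proximal points of proper, lower semi-continuous, convex functions *)

(** The form of semi-continuity used to pass to the limit along iterates: the
    bounds a k vary with k, and also show that l is in the domain of h. *)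
Lemma lower_semicontinuous_cvg (R : realType) n (h : 'cV[R]_n -> \bar R)
    (x : nat -> 'cV[R]_n) l (a : nat -> R) (b : R) : lower_semicontinuous h ->
  x @ \oo --> l -> a @ \oo --> b -> (forall k, (h (x k) <= (a k)%:E)%E) ->
  (h l <= b%:E)%E.
Proof.
move=> hlsc xl ab ha; rewrite leNgt; apply/negP => bh.
have [c bc ch] : exists2 c, b < c & (c%:E < h l)%E.
  case: (h l) bh => [r| |//].
    by rewrite lte_fin => br; exists ((b + r) / 2); rewrite ?lte_fin; lra.
  by move=> _; exists (b + 1); rewrite ?ltry// ltrDl.
have [V Vl Vh] := hlsc l c ch.
have Vx : \forall k \near \oo, V (x k) by exact: xl.
have ac : \forall k \near \oo, a k < c by move/cvgr_lt : ab; exact.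
near \oo => k.
have : (c%:E < (a k)%:E)%E by apply: lt_le_trans (ha k); apply: Vh; near: k.
rewrite lte_fin ltNge => /negP; apply; apply: ltW; near: k; exact: ac.
Unshelve. all: by end_near. Qed.

Section Prox.
Variables (R : realType) (n : nat) (h : 'cV[R]_n -> \bar R).
Hypotheses (h_proper : proper h) (h_lsc : lower_semicontinuous h).
Hypothesis h_convex : econvex h.
Implicit Types (x y v : 'cV[R]_n).

Lemma proper_fineK x : (h x < +oo)%E -> h x = (fine (h x))%:E.
Proof.
by move=> hx; rewrite fineK// fin_numE h_proper.1 lt_eqF.
Qed.

Lemma convex_fine x y t : (h x < +oo)%E -> (h y < +oo)%E -> 0 <= t <= 1 ->
  (h (t *: x + (1 - t) *: y) < +oo)%E /\
  fine (h (t *: x + (1 - t) *: y)) <= t * fine (h x) + (1 - t) * fine (h y).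
Proof.
move=> hx hy t01; have := h_convex x y t01.
rewrite (proper_fineK hx) (proper_fineK hy) -!EFinM -EFinD => hxy.
have hlt := le_lt_trans hxy (ltry _); split => //.
by move: hxy; rewrite (proper_fineK hlt) lee_fin.
Qed.

(** Semi-continuity bounds h from below on a small ball around one point of its
    domain, and convexity along the rays from that point spreads the bound to
    the whole space, at the price of a linear term. *)
Lemma convex_minorant x0 : (h x0 < +oo)%E ->
  exists2 a, 0 <= a & forall x, (h x < +oo)%E ->
    fine (h x0) - 1 - a * enorm (x - x0) <= fine (h x).
Proof.
move=> hx0; set h0 := fine (h x0).
have [V] : exists2 V : set 'cV[R]_n, nbhs x0 V &
    forall y, V y -> ((h0 - 1)%:E < h y)%E.
  by apply: h_lsc; rewrite (proper_fineK hx0) lte_fin ltrBlDr ltrDl.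
move=> /nbhs_ballP[e /= e0 eV] Vh.
exists (2 / e); first by rewrite divr_ge0// ltW.
have near_x0 y : enorm (y - x0) < e -> (h y < +oo)%E -> h0 - 1 < fine (h y).
  move=> ye hy; rewrite -lte_fin -proper_fineK//; apply/Vh/eV.
  rewrite -ball_normE/= distrC; exact: le_lt_trans (norm_le_enorm _) ye.
move=> x hx; have [xe|xe] := ltP (enorm (x - x0)) e.
  apply: le_trans (ltW (near_x0 _ xe hx)); rewrite gerBl mulr_ge0 ?enorm_ge0//.
  by rewrite divr_ge0// ltW.
set s := enorm (x - x0) in xe *.
have s0 : 0 < s by exact: lt_le_trans e0 xe.
(* t places the point of the segment from x0 to x at distance e / 2 of x0. *)
pose t := e / (2 * s).
have t0 : 0 < t by rewrite divr_gt0// mulr_gt0.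
have ts : t * s = e / 2 by rewrite /t; field; rewrite gt_eqF.
have t1 : t <= 1 by rewrite /t ler_pdivrMr ?mulr_gt0//; lra.
have t01 : 0 <= t <= 1 by rewrite ltW.
have [hp] := convex_fine hx hx0 t01.
have := near_x0 _ _ hp.
have -> : t *: x + (1 - t) *: x0 - x0 = t *: (x - x0).
  by rewrite scalerBl scale1r scalerBr addrA addrAC addrK.
rewrite enormZ gtr0_norm// -/s ts => /(_ _) H1 H2.
have {H1 H2} : h0 - 1 < t * fine (h x) + (1 - t) * h0.
  by apply: lt_le_trans H2; apply: H1; lra.
have -> : 2 / e * s = t^-1 by rewrite /t invf_div; field; rewrite !gt_eqF.
move=> H; have tV : t * t^-1 = 1 by rewrite mulfV// gt_eqF.
by rewrite -subr_ge0 -(pmulr_rge0 _ t0); nra.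
Qed.

Section Penalized.
Variables (c : R) (v : 'cV[R]_n).
Hypothesis c_gt0 : 0 < c.

Let phi x := fine (h x) + c * enorm (x - v) ^+ 2.

(** Convexity at the midpoint combined with the parallelogram identity. *)
Lemma penalized_midpoint (b : R) x y :
  (forall z, (h z < +oo)%E -> b <= phi z) -> (h x < +oo)%E -> (h y < +oo)%E ->
  b + c / 4 * enorm (x - y) ^+ 2 <= (phi x + phi y) / 2.
Proof.
move=> phib hx hy.
have t01 : 0 <= (2^-1 : R) <= 1 by lra.
have [hz hzle] := convex_fine hx hy t01.
have := phib _ hz; rewrite /phi; set z := _ + _ in hz hzle *.
have -> : enorm (z - v) ^+ 2 = 2^-1 * enorm (x - v) ^+ 2
    + 2^-1 * enorm (y - v) ^+ 2 - 4^-1 * enorm (x - y) ^+ 2.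
  rewrite !sqr_enorm /z !dotv_lin (dotvC v x) (dotvC v y) (dotvC y x).
  by field.
by move: hzle; lra.
Qed.

(** A minimizing sequence whose values are within 4^-k of the infimum is Cauchy
    by [penalized_midpoint]; semi-continuity makes its limit a minimizer. *)
Lemma penalized_min_exists :
  exists2 p, (h p < +oo)%E & forall y, (h y < +oo)%E -> phi p <= phi y.
Proof.
have [x0 hx0] := h_proper.2.
have [a a0 ha] := convex_minorant hx0.
pose S := [set phi x | x in [set x | (h x < +oo)%E]].
have S0 : S !=set0 by exists (phi x0), x0.
have lbS : has_lbound S.
  (* The minimum of c s^2 - a s over s is - a^2 / (4 c). *)
  exists (fine (h x0) - 1 - a * enorm (x0 - v) - a ^+ 2 / (4 * c)).
  move=> _ [x hx <-].
  have := ha _ hx; have := enormD (x - v) (v - x0).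
  rewrite subrKA (enormB v) /phi; set s := enorm (x - v).
  have : 0 <= c * (s - a / (2 * c)) ^+ 2 by rewrite mulr_ge0 ?sqr_ge0// ltW.
  have -> : c * (s - a / (2 * c)) ^+ 2 = c * s ^+ 2 - a * s + a ^+ 2 / (4 * c).
    by field; rewrite gt_eqF.
  by move=> ? ? ?; nra.
pose b := inf S.
have phib z : (h z < +oo)%E -> b <= phi z.
  by move=> hz; apply: ge_inf => //; exists z.
have ex k : exists x, (h x < +oo)%E /\ phi x < b + 4^-1 ^+ k.
  have : has_inf S by split.
  move=> /(@inf_adherent _ _ (4^-1 ^+ k)) [|_ [x hx <-] xb].
    by rewrite exprn_gt0.
  by exists x.
pose x k := projT1 (cid (ex k)).
have hx k : (h (x k) < +oo)%E by rewrite /x; case: cid => ? [].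
have xb k : phi (x k) < b + 4^-1 ^+ k by rewrite /x; case: cid => ? [].
have [||k|l xl _] := @geometric_limit R n x (Num.sqrt (4 / c)) 2^-1.
- by lra.
- exact: sqrtr_ge0.
- apply: enorm_le; first by rewrite mulr_ge0 ?sqrtr_ge0// exprn_ge0.
  rewrite exprMn sqr_sqrtr -?sqr_enorm; last by rewrite divr_ge0// ltW.
  have := penalized_midpoint phib (hx k.+1) (hx k).
  have := xb k; have := xb k.+1.
  rewrite -exprM mulnC exprM (_ : 2^-1 ^+ 2 = 4^-1 :> R); last by field.
  rewrite exprS; set e := 4^-1 ^+ k; have e0 : 0 < e by rewrite exprn_gt0.
  move=> *; rewrite mulrAC ler_pdivlMr//; nra.
have hl : (h l <= (b - c * enorm (l - v) ^+ 2)%:E)%E.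
  pose ak k := b + 4^-1 ^+ k - c * enorm (x k - v) ^+ 2.
  apply: (@lower_semicontinuous_cvg _ _ _ x l ak) => //.
    rewrite -[b in b - _]addr0; apply: cvgB; first apply: cvgD.
    - exact: cvg_cst.
    - by apply: cvg_expr; rewrite ger0_norm//; lra.
    - have xv : enorm (x k - v) @[k --> \oo] --> enorm (l - v).
        apply: (continuous_cvg _ (@enorm_continuous R n _)).
        by apply: cvgB => //; exact: cvg_cst.
      by apply: cvgM; [exact: cvg_cst|exact: cvgM].
  move=> k; rewrite (proper_fineK (hx k)) lee_fin /ak.
  by have := xb k; rewrite /phi; lra.
have hl' := le_lt_trans hl (ltry _); exists l => //.
move=> y hy; apply: le_trans (phib _ hy).
by move: hl; rewrite (proper_fineK hl') lee_fin /phi; lra.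
Qed.

End Penalized.

(** Completing the square: the proximal point of a gradient step minimizes the
    linearization with quadratic penalty. *)
Lemma prox_step_min (Lf : R) x G : 0 < Lf ->
  let p := prox (1 / Lf) h (x - (1 / Lf) *: G) in
  let psi y := dotv G (y - x) + Lf / 2 * enorm (y - x) ^+ 2 + fine (h y) in
  (h p < +oo)%E /\ forall y, (h y < +oo)%E -> psi p <= psi y.
Proof.
move=> Lf0 p psi; set v := x - (1 / Lf) *: G in p *.
have c0 : 0 < (2 * (1 / Lf))^-1 :> R by rewrite invr_gt0 mulr_gt0 ?divr_gt0.
have [q hq q_min] := penalized_min_exists v c0.
have : forall y, (h p + ((2 * (1 / Lf))^-1 * enorm (p - v) ^+ 2)%:E <=
    h y + ((2 * (1 / Lf))^-1 * enorm (y - v) ^+ 2)%:E)%E.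
  rewrite /p /prox; case: xgetP => [z _ //|/(_ q)] []; move=> y /=.
  have [hy|hy] := ltP (h y) +oo%E; last first.
    by move: hy; rewrite leye_eq => /eqP->; rewrite addye// leey.
  by rewrite (proper_fineK hq) (proper_fineK hy) -!EFinD lee_fin q_min.
move=> p_min.
have hp : (h p < +oo)%E.
  rewrite ltNge; apply/negP; rewrite leye_eq => /eqP hp.
  by have := p_min q; rewrite hp addye// (proper_fineK hq) -EFinD leye_eq.
split => // y hy; have := p_min y.
rewrite (proper_fineK hp) (proper_fineK hy) -!EFinD lee_fin.
have sq z : (2 * (1 / Lf))^-1 * enorm (z - v) ^+ 2 =
   dotv G (z - x) + Lf / 2 * enorm (z - x) ^+ 2 + (2 * Lf)^-1 * enorm G ^+ 2.
  rewrite !sqr_enorm (_ : z - v = (z - x) + (1 / Lf) *: G); last first.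
    by rewrite opprB [_ *: _ - x]addrC addrA.
  move: (z - x) => w; rewrite !dotv_lin (dotvC w G); field; exact: lt0r_neq0.
by rewrite !sq /psi; lra.
Qed.

End Prox.

(** * The proximal gradient step under the proximal PL condition *)

Section ProxGradient.
Variables (R : realType) (n : nat) (f : 'cV[R]_n -> R) (h : 'cV[R]_n -> \bar R).
Variables (Lf alpha : R).
Hypotheses (f_diff : forall x, differentiable f x) (Lf_gt0 : 0 < Lf).
Hypothesis f_lip : lipschitz_grad f Lf.
Hypotheses (h_proper : proper h) (h_lsc : lower_semicontinuous h).
Hypothesis h_convex : econvex h.
Hypothesis alpha_bnd : 0 < alpha < Lf.
Hypothesis PL : prox_PL f h (1 / Lf) alpha.
Implicit Types (x y z : 'cV[R]_n).

Let T := prox_grad f h (1 / Lf).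
Let Fmin := fine (infval (objective f h)).

(** Real-valued for ease of computation; the value is the suboptimality
    F y - min F only where h y is finite. *)
Definition subopt y := f y + fine (h y) - Fmin.

Let E := subopt.

(** The quadratic upper bound of f at x given by [descent_lemma]. *)
Definition majorant x y :=
  f x + dotv (grad f x) (y - x) + Lf / 2 * enorm (y - x) ^+ 2.

Let hK := proper_fineK h_proper.

Lemma infvalK : infval (objective f h) = Fmin%:E.
Proof. by have [fin _ _] := PL; rewrite /Fmin fineK. Qed.

Lemma subopt_ge0 y : (h y < +oo)%E -> 0 <= E y.
Proof.
move=> hy; have : (infval (objective f h) <= objective f h y)%E.
  by apply: ereal_inf_lbound; exists y.
by rewrite infvalK /objective (hK hy) -EFinD lee_fin subr_ge0.
Qed.

Lemma opt_setP x :
  opt_set (objective f h) x <-> (h x < +oo)%E /\ E x = 0.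
Proof.
rewrite /opt_set /= infvalK /objective; split=> [Fx|[hx]].
  have hx : (h x < +oo)%E.
    rewrite ltNge leye_eq; apply/negP => /eqP hx.
    by move: Fx; rewrite hx addey.
  split=> //; move: Fx; rewrite (hK hx) -EFinD.
  by move=> [Fx]; rewrite /E /subopt Fx subrr.
by move/eqP; rewrite /E /subopt subr_eq0 (hK hx) -EFinD => /eqP ->.
Qed.

Lemma opt_set_nonempty : opt_set (objective f h) !=set0.
Proof. by have [_ [xs Fxs] _] := PL; exists xs. Qed.

Lemma prox_grad_fin x : (h (T x) < +oo)%E.
Proof. exact: (prox_step_min h_proper h_lsc h_convex x (grad f x) Lf_gt0).1. Qed.

Lemma majorant_prox_grad x z : (h z < +oo)%E ->
  majorant x (T x) + fine (h (T x)) <= majorant x z + fine (h z).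
Proof.
move=> hz; have [_] := prox_step_min h_proper h_lsc h_convex x (grad f x) Lf_gt0.
by move=> /(_ z hz); rewrite /majorant -!addrA lerD2l.
Qed.

Lemma subopt_prox_grad_le x z : (h z < +oo)%E ->
  E (T x) <= majorant x z + fine (h z) - Fmin.
Proof.
move=> hz; have := majorant_prox_grad x hz.
have := descent_lemma f_diff x (T x) f_lip.
by rewrite /E /subopt /majorant; lra.
Qed.

(** The infimum in the definition of the gap is attained at T x. *)
Lemma PL_decrease x : (h x < +oo)%E ->
  majorant x (T x) + fine (h (T x)) - Fmin <= (1 - alpha / Lf) * E x.
Proof.
move=> hx; have hT := prox_grad_fin x.
have [_ _ /(_ x hx)] := PL.
rewrite /prox_gap; set gap := ereal_inf _.
have -> : gap = (majorant x (T x) - f x + fine (h (T x)) - fine (h x))%:E.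
  have c : (2 * (1 / Lf))^-1 = Lf / 2 by field; rewrite gt_eqF.
  apply/eqP; rewrite eq_le; apply/andP; split.
    apply: ereal_inf_lbound; exists (T x) => //.
    rewrite (hK hx) (hK hT) -EFinB -EFinD c /majorant; congr (_%:E); ring.
  apply/ereal_infP => _ [y _ <-]; rewrite c.
  have [hy|] := ltP (h y) +oo%E; last first.
    by rewrite leye_eq => /eqP->; rewrite (hK hx) addye// addey// leey.
  rewrite (hK hx) (hK hy) -EFinB -EFinD lee_fin.
  by have := majorant_prox_grad x hy; rewrite /majorant; lra.
have -> : (objective f h x - infval (objective f h) = (E x)%:E)%E.
  by rewrite infvalK /objective (hK hx).
rewrite -EFinN -!EFinM lee_fin; set M := majorant _ _ => H.
have {}H : alpha / Lf * E x <= - (M - f x + fine (h (T x)) - fine (h x)).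
  rewrite mulrAC ler_pdivrMr//; apply: le_trans H _.
  by rewrite le_eqVlt; apply/orP; left; apply/eqP; field; rewrite gt_eqF.
by move: H; rewrite /E /subopt; lra.
Qed.

Lemma subopt_prox_grad x : (h x < +oo)%E -> E (T x) <= (1 - alpha / Lf) * E x.
Proof.
move=> hx; apply: le_trans (PL_decrease hx); apply: subopt_prox_grad_le.
exact: prox_grad_fin.
Qed.

Lemma rate_itv : 0 < 1 - alpha / Lf < 1.
Proof.
case/andP: alpha_bnd => a0 aL.
by rewrite subr_gt0 ltr_pdivrMr// mul1r aL gtrBl divr_gt0.
Qed.

(** The penalized linearization is strongly convex in its target, takes the value
    F x at x, and is minimal at T x. Comparing T x with the midpoint of T x and x
    is enough to bound the step. *)
Lemma prox_grad_step_le x : (h x < +oo)%E ->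
  enorm (T x - x) ^+ 2 <= 4 / Lf * E x.
Proof.
move=> hx; have hT := prox_grad_fin x.
rewrite mulrAC ler_pdivlMr//.
have t01 : 0 <= (2^-1 : R) <= 1 by lra.
have [hz hle] := convex_fine h_proper h_convex hT hx t01.
have := majorant_prox_grad x hz; move: hle; rewrite /majorant.
set z := _ + _ in hz *; have -> : z - x = 2^-1 *: (T x - x).
  rewrite /z scalerBr -addrA; congr (_ + _).
  by rewrite -{2}(scale1r x) -scalerBl -scaleNr; congr (_ *: _); field.
have := descent_lemma f_diff x (T x) f_lip; have := subopt_ge0 hT.
rewrite dotvZr enormZ exprMn ger0_norm; last by lra.
rewrite /E /subopt; set u := enorm _ ^+ 2; nra.
Qed.

(** Quadratic growth: the steps of the iteration started at y decay
    geometrically, so it converges to an optimal point at a distance from y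
    controlled by its first step. *)
Lemma quadratic_growth : exists2 c, 0 < c & forall y, (h y < +oo)%E ->
  exists2 xs, opt_set (objective f h) xs & enorm (y - xs) ^+ 2 <= c * E y.
Proof.
have /andP[q0 q1] := rate_itv; set q := 1 - alpha / Lf in q0 q1 *.
pose s := Num.sqrt q.
have ss : s ^+ 2 = q by rewrite sqr_sqrtr// ltW.
have s0 : 0 <= s by exact: sqrtr_ge0.
have s1 : s < 1 by nra.
exists (4 / Lf / (1 - s) ^+ 2).
  by rewrite !divr_gt0// exprn_gt0// subr_gt0.
move=> y hy; pose x k := iter k T y.
have hx k : (h (x k) < +oo)%E by case: k => // k; exact: prox_grad_fin.
have Ex k : E (x k) <= q ^+ k * E y.
  elim: k => [|k ih]; first by rewrite mul1r.
  apply: le_trans (subopt_prox_grad (hx k)) _.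
  by rewrite exprS -mulrA ler_wpM2l// ltW.
have Ey := subopt_ge0 hy.
pose c := Num.sqrt (4 / Lf * E y).
have c0 : 0 <= c by exact: sqrtr_ge0.
have cc : c ^+ 2 = 4 / Lf * E y.
  by rewrite sqr_sqrtr// mulr_ge0// divr_ge0// ltW.
have [||k|l xl lx] := @geometric_limit R n x c s.
- by rewrite s0.
- by [].
- apply: enorm_le; first by rewrite mulr_ge0// exprn_ge0.
  rewrite -sqr_enorm exprMn cc -exprM mulnC exprM ss.
  apply: le_trans (prox_grad_step_le (hx k)) _.
  by rewrite -(mulrA _ (E y)) ler_wpM2l ?divr_ge0 ?(ltW Lf_gt0)// mulrC.
have hl : (h l <= (Fmin - f l)%:E)%E.
  apply: (@lower_semicontinuous_cvg _ _ _ x l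
    (fun k => Fmin + q ^+ k * E y - f (x k))) => //.
    rewrite -[Fmin in Fmin - _]addr0; apply: cvgB; first apply: cvgD.
    - exact: cvg_cst.
    - rewrite -(mul0r (E y)); apply: cvgM; last exact: cvg_cst.
      by apply: cvg_expr; rewrite gtr0_norm.
    - by apply: continuous_cvg => //; exact: differentiable_continuous.
  move=> k; rewrite (hK (hx k)) lee_fin.
  by have := Ex k; rewrite /E /subopt; lra.
have hl' := le_lt_trans hl (ltry _); exists l.
  apply/opt_setP; split => //; apply/eqP; rewrite eq_le subopt_ge0// andbT.
  by move: hl; rewrite (hK hl') lee_fin /E /subopt; lra.
rewrite enormB mulrAC -cc -expr_div_n ler_pXn2r// nnegrE ?enorm_ge0//.
by rewrite divr_ge0// subr_ge0 ltW.
Qed.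

(** T x does at least as well as the solution xs in the penalized linearization,
    whose value at xs exceeds F xs by at most 2 Lf |x - xs|^2. It holds outside
    the domain of h as well, hence at every initial condition. *)
Lemma subopt_prox_grad_dist x xs : opt_set (objective f h) xs ->
  E (T x) <= 2 * Lf * enorm (x - xs) ^+ 2.
Proof.
move=> /opt_setP[hxs Exs]; have := subopt_prox_grad_le x hxs.
have := descent_lemma f_diff xs x f_lip.
have := f_lip x xs; have := cauchy_schwarz (grad f x - grad f xs) (xs - x).
move: Exs; rewrite /E /subopt /majorant (enormB xs).
rewrite -(opprB x xs) !dotv_lin; set u := enorm (x - xs).
by have := enorm_ge0 (x - xs); rewrite -/u; nra.
Qed.

(** Moving the base point of a step by u changes the majorant, as a function of
    the target z, by a linear function of slope at most 2 Lf |u|, up to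
    2 Lf |u|^2. At z = T y the linear term is absorbed by half of the decrease
    granted by the PL condition, thanks to [prox_grad_step_le]. *)
Lemma subopt_prox_grad_perturbed x y : (h y < +oo)%E ->
  E (T x) <= (1 - alpha / (2 * Lf)) * E y
    + (2 * Lf + 8 * Lf ^+ 2 / alpha) * enorm (x - y) ^+ 2.
Proof.
case/andP: alpha_bnd => a0 aL hy; have hT := prox_grad_fin y.
apply: le_trans (subopt_prox_grad_le x hT) _.
have := PL_decrease hy; have := prox_grad_step_le hy.
have := descent_lemma f_diff y x f_lip.
rewrite /majorant; set z := T y.
have -> : z - x = (z - y) - (x - y) by rewrite opprB addrA subrK.
have := cauchy_schwarz (grad f x - grad f y) (z - y).
have := cauchy_schwarz (grad f x - grad f y) (- (x - y)).
have := cauchy_schwarz (- (z - y)) (x - y).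
have := f_lip x y; have := enorm_ge0 (x - y); have := enorm_ge0 (z - y).
rewrite !enormN (sqr_enorm (_ - (x - y))).
move: (x - y) (z - y) => u w; rewrite !dotv_lin (dotvC u w) -!sqr_enorm.
set a := enorm u; set b := enorm w; set D := enorm _.
move=> b_ge0 a_ge0 lip cs1 cs2 cs3 desc step dec.
have Db : D * b <= Lf * a * b by rewrite ler_wpM2r.
have {}cs1 : Lf * - dotv w u <= Lf * (b * a) by rewrite ler_wpM2l// ltW.
have Da : D * a <= Lf * a * a by rewrite ler_wpM2r.
(* Young's inequality; the weight leaves half of the rate alpha / Lf. *)
have young : 2 * Lf * a * b <= alpha / 8 * b ^+ 2 + 8 * Lf ^+ 2 / alpha * a ^+ 2.
  have : 0 <= 8 / alpha * (Lf * a - alpha / 8 * b) ^+ 2.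
    by rewrite mulr_ge0 ?sqr_ge0// divr_ge0// ltW.
  have -> : 8 / alpha * (Lf * a - alpha / 8 * b) ^+ 2 =
      8 * Lf ^+ 2 / alpha * a ^+ 2 - 2 * Lf * a * b + alpha / 8 * b ^+ 2.
    by field; rewrite gt_eqF.
  by lra.
have {}step : alpha / 8 * b ^+ 2 <= alpha / (2 * Lf) * E y.
  have -> : alpha / (2 * Lf) * E y = alpha / 8 * (4 / Lf * E y).
    by field; rewrite gt_eqF.
  by rewrite ler_wpM2l// divr_ge0// ltW.
have : alpha / Lf = 2 * (alpha / (2 * Lf)) by field; rewrite gt_eqF.
move: dec step; rewrite /E /subopt; lra.
Qed.

End ProxGradient.

(** * The affine constraint *)

Section Affine.
Variables (R : realType) (m n : nat) (C : 'M[R]_(m, n)) (d : 'cV[R]_m).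
Implicit Types (x y w : 'cV[R]_n).

Section Projection.
Hypothesis C_rank : \rank C = m.

(** If v C C^T = 0 then |C^T v^T|^2 = 0. *)
Lemma gram_unitmx : C *m C^T \in unitmx.
Proof.
rewrite -row_free_unit; apply: inj_row_free => v vCC.
have Cv : C^T *m v^T = 0.
  apply: dotv_eq0; rewrite dotvE trmx_mul !trmxK -mulmxA (mulmxA C) mulmxA vCC.
  by rewrite mul0mx mxE.
have C_free : row_free C by rewrite /row_free C_rank.
apply/eqP; rewrite -(mulmx_free_eq0 _ C_free) -trmx_eq0 trmx_mul Cv.
exact: eqxx.
Qed.

Lemma mulmx_pinv (v : 'cV[R]_m) : C *m (C^T *m invmx (C *m C^T) *m v) = v.
Proof. by rewrite !mulmxA mulmxV ?gram_unitmx// mul1mx. Qed.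

(** The residual w - p is in the range of C^T, hence orthogonal to the directions
    of the affine set, and Pythagoras applies. *)
Lemma proj_affine w :
  proj (affine_set C d) w = w - C^T *m invmx (C *m C^T) *m (C *m w + d).
Proof.
set p := w - _.
have Cp : affine_set C d p.
  by rewrite /affine_set /= /p mulmxBr mulmx_pinv opprD addrA subrr sub0r addNr.
have pyth q : affine_set C d q ->
    enorm (w - q) ^+ 2 = enorm (w - p) ^+ 2 + enorm (p - q) ^+ 2.
  move=> Cq.
  have : dotv (w - p) (p - q) = 0.
    rewrite dotvC {2}/p subKr -mulmxA dotv_mulmx trmxK mulmxBr.
    have -> : C *m p = C *m q by apply: (addIr d); exact: etrans Cp (esym Cq).
    by rewrite subrr dotv0l.
  rewrite -(subrKA p w (- q)) !sqr_enorm; move: (w - p) (p - q) => u v uv.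
  by rewrite !dotv_lin (dotvC v u) uv; ring.
rewrite /proj; case: xgetP => [q _ [Cq qmin]|/(_ p)] /=; last first.
  case; split=> // q Cq; rewrite -(ler_pXn2r (_ : 0 < 2)%N) ?nnegrE ?enorm_ge0//.
  by rewrite (pyth q)// lerDl sqr_ge0.
apply/esym/eqP; rewrite -subr_eq0; apply/eqP/dotv_eq0/eqP.
rewrite eq_le dotv_ge0 andbT -sqr_enorm.
have := qmin p Cp; rewrite -(ler_pXn2r (_ : 0 < 2)%N) ?nnegrE ?enorm_ge0//.
by rewrite (pyth q)// gerDl.
Qed.

End Projection.

Lemma affine_continuous i : continuous (fun x : 'cV[R]_n => (C *m x + d) i 0).
Proof.
have -> : (fun x : 'cV[R]_n => (C *m x + d) i 0) =
    (fun x => \sum_j C i j * x j 0 + d i 0) by apply/funext => x; rewrite !mxE.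
move=> x; apply: continuousD; last by apply: cst_continuous.
apply: continuous_big => [|j _ {}x]; first exact: add_continuous.
have cj := @coord_continuous R n 1 j 0 x.
by apply: (continuousM _ cj); apply: cst_continuous.
Qed.

Variable g : 'cV[R]_n -> \bar R.
Hypotheses (g_proper : proper g) (g_lsc : lower_semicontinuous g).
Hypothesis g_convex : econvex g.

Lemma gbar_in x : affine_set C d x -> gbar g C d x = g x.
Proof. by move=> Cx; rewrite /gbar /indic0 mem_set// adde0. Qed.

Lemma gbar_out x : ~ affine_set C d x -> gbar g C d x = +oo%E.
Proof.
by move=> Cx; rewrite /gbar /indic0 memNset// addey// g_proper.1.
Qed.

Lemma gbar_fin x : (gbar g C d x < +oo)%E -> affine_set C d x.
Proof.
by have [//|/gbar_out->] := pselect (affine_set C d x).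
Qed.

Lemma gbar_ge x : (g x <= gbar g C d x)%E.
Proof.
by have [/gbar_in->|/gbar_out->] := pselect (affine_set C d x); rewrite ?leey.
Qed.

Lemma gbar_proper : (exists x, (gbar g C d x < +oo)%E) -> proper (gbar g C d).
Proof.
split=> // x; apply/eqP => gx; have := gbar_ge x.
by rewrite gx leeNy_eq (negbTE (g_proper.1 x)).
Qed.

Lemma gbar_lsc : lower_semicontinuous (gbar g C d).
Proof.
move=> x a; have [Cx|Cx] := pselect (affine_set C d x).
  rewrite gbar_in// => /g_lsc[V Vx Vg]; exists V => // y /Vg /lt_le_trans; apply.
  exact: gbar_ge.
move=> _; have [i Ci] : exists i, (C *m x + d) i 0 != 0.
  apply/not_existsP => Ci; apply: Cx; apply/colP => i; rewrite [RHS]mxE.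
  by apply/eqP/negPn/negP; exact: Ci.
exists [set y | (C *m y + d) i 0 != 0].
  apply: (@affine_continuous i x [set r : R | r != 0]).
  by apply: open_nbhs_nbhs; split => //; exact: open_neq.
move=> y /= Cy; rewrite gbar_out ?ltry// => Cy0; move: Cy.
by rewrite Cy0 mxE eqxx.
Qed.

Lemma gbar_convex : econvex (gbar g C d).
Proof.
move=> x y t t01; have /andP[t0 t1] := t01.
have [->|tn0] := eqVneq t 0.
  by rewrite scale0r add0r subr0 scale1r mul0e add0e mul1e.
have [->|tn1] := eqVneq t 1.
  by rewrite subrr scale0r addr0 scale1r mul0e adde0 mul1e.
have tp : 0 < t by rewrite lt_neqAle eq_sym tn0.
have t'p : 0 < 1 - t by rewrite subr_gt0 lt_neqAle tn1.
have mulNy (s : R) z : 0 < s -> (s%:E * gbar g C d z != -oo)%E.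
  move=> s0; have := gbar_ge z; have := g_proper.1 z.
  case: (gbar g C d z) => [r _ _| _ _|gz]; first by rewrite -EFinM.
    by rewrite gt0_muley ?lte_fin.
  by rewrite leeNy_eq (negbTE gz).
have [Cx|Cx] := pselect (affine_set C d x); last first.
  by rewrite (gbar_out Cx) gt0_muley ?lte_fin// addye ?leey// mulNy.
have [Cy|Cy] := pselect (affine_set C d y); last first.
  by rewrite (gbar_out Cy) gt0_muley ?lte_fin// addey ?leey// mulNy.
rewrite !gbar_in//; first exact: g_convex.
have xd : C *m x = - d by apply/eqP; rewrite -addr_eq0; apply/eqP.
have yd : C *m y = - d by apply/eqP; rewrite -addr_eq0; apply/eqP.
rewrite /affine_set /= mulmxDr -!scalemxAr xd yd -scalerDl addrCA subrr addr0.
by rewrite scale1r addNr.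
Qed.

End Affine.

(** * The linear subsystem *)

Section LinearLyapunov.
Variables (R : realType) (p : nat) (N Q : 'M[R]_p) (re : R).
Hypotheses (Q_sym : Q^T = Q) (Q_posdef : posdefmx Q).
Hypothesis N_decay : negdefmx (N *m Q *m N^T - (1 - re) *: Q).
Hypothesis re_lt1 : re < 1.
Implicit Types x y z : 'cV[R]_p.

Lemma posdef_ge0 z : 0 <= dotv z (Q *m z).
Proof.
have [->|z0] := eqVneq z 0; first by rewrite mulmx0 dotv_ge0.
by rewrite dotvE mulmxA ltW// Q_posdef.
Qed.

Lemma posdef_unitmx : Q \in unitmx.
Proof.
rewrite -row_free_unit; apply: inj_row_free => v vQ; apply: contrapT => /eqP v0.
have := Q_posdef (z := v^T); rewrite trmx_eq0 => /(_ v0).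
by rewrite trmxK vQ mul0mx mxE ltxx.
Qed.

(** The squared norm dual to that of Q. Decrease along N, rather than along its
    transpose, holds for the inverse of Q. *)
Definition lyap z := dotv (invmx Q *m z) z.

Lemma lyapE z : lyap z = dotv (invmx Q *m z) (Q *m (invmx Q *m z)).
Proof. by rewrite mulKVmx// posdef_unitmx. Qed.

Lemma lyap_ge0 z : 0 <= lyap z.
Proof. by rewrite lyapE posdef_ge0. Qed.

Lemma lyap_le : exists2 c, 0 < c & forall z, lyap z <= c * enorm z ^+ 2.
Proof.
have [c c0 hc] := mulmx_bounded (invmx Q).
exists (c / 2 + 2^-1) => [|z]; first by lra.
have := dotv_ge0 (invmx Q *m z - z); have := hc z.
by rewrite !sqr_enorm !dotv_lin (dotvC z) /lyap; lra.
Qed.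

(** Cauchy-Schwarz for the form of Q, between invmx Q *m z and z, gives
    |z|^4 <= lyap z * (z^T Q z), and the last factor is at most of order |z|^2. *)
Lemma lyap_ge : exists2 c, 0 < c & forall z, enorm z ^+ 2 <= c * lyap z.
Proof.
have [c c0 hc] := mulmx_bounded Q.
exists (c / 2 + 2^-1) => [|z]; first by lra.
have [->|z0] := eqVneq z 0.
  by rewrite enorm0 expr0n mulr_ge0 ?lyap_ge0//; lra.
have zz : 0 < enorm z ^+ 2.
  rewrite lt_neqAle sqr_ge0 andbT eq_sym; apply: contra z0 => /eqP.
  by rewrite sqr_enorm => /dotv_eq0 ->.
have := psd_cauchy_schwarz (invmx Q *m z) z Q_sym posdef_ge0.
rewrite dotv_mulmx Q_sym mulKVmx ?posdef_unitmx// -sqr_enorm -/(lyap z).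
have : dotv z (Q *m z) <= (c / 2 + 2^-1) * enorm z ^+ 2.
  have := dotv_ge0 (Q *m z - z); have := hc z.
  by rewrite !sqr_enorm !dotv_lin (dotvC z); lra.
move=> H1 H2; rewrite -(ler_pM2r zz) -expr2; apply: le_trans H2 _.
by rewrite mulrAC mulrC ler_wpM2r// lyap_ge0.
Qed.

(** The hypothesis says that N^T contracts the norm of Q; its adjoint N then
    contracts the dual norm, that of invmx Q. The duality is Cauchy-Schwarz with
    y := invmx Q *m (N *m z). *)
Lemma lyap_decay z : lyap (N *m z) <= (1 - re) * lyap z.
Proof.
set w := N *m z; pose y := invmx Q *m w.
have q0 : 0 < 1 - re by rewrite subr_gt0.
have Ny v : dotv (N^T *m v) (Q *m (N^T *m v)) <= (1 - re) * dotv v (Q *m v).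
  have [->|v0] := eqVneq v 0; first by rewrite !mulmx0 dotv0l mulr0.
  have := N_decay v0; rewrite mulmxBr mulmxBl -scalemxAr -scalemxAl.
  have entry (A B : 'M[R]_1) :
    (A - (1 - re) *: B) 0 0 = A 0 0 - (1 - re) * B 0 0 by rewrite !mxE.
  rewrite entry subr_lt0 => /ltW.
  by rewrite !dotvE trmx_mul trmxK !mulmxA.
have Vw : dotv y (Q *m y) = lyap w by rewrite lyapE.
have := psd_cauchy_schwarz (N^T *m y) (invmx Q *m z) Q_sym posdef_ge0.
rewrite -lyapE mulKVmx ?posdef_unitmx// -dotv_mulmx -/w -/(lyap w).
move: (Ny y); rewrite Vw => {}Ny cs.
have [w0|w0] := eqVneq (lyap w) 0; first by rewrite w0 mulr_ge0 ?lyap_ge0// ltW.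
have {}w0 : 0 < lyap w by rewrite lt_neqAle eq_sym w0 lyap_ge0.
rewrite -(ler_pM2r w0) -expr2; apply: le_trans cs _.
by rewrite mulrAC ler_wpM2r// lyap_ge0.
Qed.

End LinearLyapunov.

(** * Exponential stability *)

Section Stability.
Variables (R : realType) (n m : nat).
Implicit Types (z a : 'cV[R]_n * 'cV[R]_m) (A : set ('cV[R]_n * 'cV[R]_m)).

Definition sqdist z a := enorm (z.1 - a.1) ^+ 2 + enorm (z.2 - a.2) ^+ 2.

Lemma sqdist_ge0 z a : 0 <= sqdist z a.
Proof. by rewrite addr_ge0// sqr_ge0. Qed.

Lemma edist2_le z a A : A a -> edist2 z A <= Num.sqrt (sqdist z a).
Proof.
move=> Aa; apply: ge_inf; last by exists a.
by exists 0 => _ [b _ <-]; exact: sqrtr_ge0.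
Qed.

Lemma edist2_ge z A b : A !=set0 ->
  (forall a, A a -> b <= Num.sqrt (sqdist z a)) -> b <= edist2 z A.
Proof.
move=> [a Aa] Ab; apply: lb_le_inf; first by exists (Num.sqrt (sqdist z a)), a.
by move=> _ [a' Aa' <-]; exact: Ab.
Qed.

(** The squared distance at z bounds W at T z rather than at z, since z may be
    outside D. The decay is therefore counted from T z, and the constant absorbs
    the first step. *)
Lemma lyapunov_exp_stable T A (D : set ('cV[R]_n * 'cV[R]_m)) (W : _ -> R)
    (q clow cup : R) : A !=set0 -> 0 < q < 1 -> 0 < clow -> 0 < cup ->
  (forall z, D (T z)) ->
  (forall z, D z -> W (T z) <= q * W z) ->
  (forall z, D z -> exists2 a, A a & sqdist z a <= clow * W z) ->
  (forall z a, A a -> W (T z) <= cup * sqdist z a) ->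
  glob_exp_stable T A.
Proof.
move=> A0 /andP[q0 q1] clow0 cup0 DT WT Wlow Wup.
(* W decays at the rate q and compares to the square of the distance. *)
pose r := Num.sqrt q; have rr : r ^+ 2 = q by rewrite sqr_sqrtr// ltW.
have r0 : 0 < r by rewrite sqrtr_gt0.
have r1 : r < 1 by nra.
(* Division by q: there is one contraction less than there are steps. *)
pose k0 := Num.sqrt (clow * cup / q).
have k0_ge0 : 0 <= k0 by exact: sqrtr_ge0.
exists (k0 + 1), r; split; first by rewrite ltr_wpDl.
  by rewrite r0.
move=> z0 [|k].
  rewrite /= expr0 mulr1 -[leLHS]mul1r ler_wpM2r ?lerDr//.
  by apply: edist2_ge => // a _; exact: sqrtr_ge0.
set M := (k0 + 1) * r ^+ k.+1.
have M0 : 0 < M by rewrite mulr_gt0 ?exprn_gt0// ltr_wpDl.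
rewrite mulrC -ler_pdivrMr//; apply: edist2_ge => // a Aa.
rewrite ler_pdivrMr//.
have Dk j : D (iter j T (T z0)) by case: j => [|j]; exact: DT.
have Wk j : W (iter j T (T z0)) <= q ^+ j * W (T z0).
  elim: j => [|j ih]; first by rewrite mul1r.
  apply: le_trans (WT _ (Dk j)) _.
  by rewrite exprS -mulrA ler_wpM2l// ltW.
rewrite iterSr; have [b Ab zb] := Wlow _ (Dk k).
apply: le_trans (edist2_le _ Ab) _.
have s0 := sqdist_ge0 z0 a.
apply: (@le_trans _ _ (k0 * r ^+ k.+1 * Num.sqrt (sqdist z0 a))); last first.
  rewrite mulrC ler_wpM2l ?sqrtr_ge0// ler_wpM2r ?exprn_ge0 ?lerDl//.
  exact: ltW.
rewrite -(ler_pXn2r (_ : 0 < 2)%N) ?nnegrE ?sqrtr_ge0 ?mulr_ge0 ?exprn_ge0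
  ?sqrtr_ge0 ?(ltW r0)//.
rewrite !exprMn !sqr_sqrtr ?sqdist_ge0//; last first.
  by rewrite !mulr_ge0 ?invr_ge0// ltW.
apply: le_trans zb _; rewrite -exprM mulnC exprM rr exprS.
have -> : clow * cup / q * (q * q ^+ k) * sqdist z0 a =
   clow * (q ^+ k * (cup * sqdist z0 a)) by field; rewrite gt_eqF.
rewrite ler_wpM2l ?(ltW clow0)//; apply: le_trans (Wk k) _.
by rewrite ler_wpM2l ?exprn_ge0 ?(ltW q0)// Wup.
Qed.

End Stability.

Lemma sqr_enorm_col_mx (R : realType) m1 m2 (a : 'cV[R]_m1) (b : 'cV[R]_m2) :
  enorm (col_mx a b) ^+ 2 = enorm a ^+ 2 + enorm b ^+ 2.
Proof.
rewrite !sqr_enorm /dotv big_split_ord; congr (_ + _); apply: eq_bigr => i _.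
  by rewrite col_mxEu.
by rewrite col_mxEd.
Qed.

Theorem theorem2 (R : realType) (n m : nat)
    (f : 'cV[R]_n -> R) (Lf : R) (g : 'cV[R]_n -> \bar R)
    (C : 'M[R]_(m, n)) (d : 'cV[R]_m) (alpha : R) (K L : 'M[R]_m)
    (hf : forall x, differentiable f x)
    (hLf : 0 < Lf)
    (hgrad : lipschitz_grad f Lf)
    (hg_proper : proper g)
    (hg_lsc : lower_semicontinuous g)
    (hg_convex : econvex g)
    (hC : \rank C = m)
    (hcompat : forall w : 'cV[R]_n,
      proj (affine_set C d) (prox (1 / Lf) g w) = prox (1 / Lf) (gbar g C d) w)
    (halpha : 0 < alpha < Lf)
    (hPL : prox_PL f (gbar g C d) (1 / Lf) alpha)
    (hN : exists (Q : 'M[R]_(m + m)) (re : R),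
      let N := block_mx 0 1%:M L K in
      [/\ Q^T = Q, posdefmx Q, 0 < re < 1 &
          negdefmx (N *m Q *m N^T - (1 - re) *: Q)]) :
  glob_exp_stable (dynamics f g C d K L (1 / Lf))
    (opt_set (objective f (gbar g C d)) `*` [set 0]).
Proof.
have [Q [re []]] := hN.
set N := block_mx _ _ _ _ => Qsym Qpos /andP[re0 re1] Ndecay.
set h := gbar g C d in hcompat hPL *.
have h_dom : exists x, (h x < +oo)%E.
  have [xs Fxs] := opt_set_nonempty hPL; exists xs.
  rewrite ltNge leye_eq; apply/negP => /eqP hxs.
  by have [+ _ _] := hPL; rewrite -Fxs /objective hxs addey.
have h_proper : proper h by exact: gbar_proper.
have h_lsc : lower_semicontinuous h by exact: gbar_lsc.
have h_convex : econvex h by exact: gbar_convex.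
pose T := prox_grad f h (1 / Lf); pose E := subopt f h.
pose Cp := C^T *m invmx (C *m C^T).
pose y (x : 'cV[R]_n) := x - Cp *m (C *m x + d).
have CCp (v : 'cV[R]_m) : C *m (Cp *m v) = v by exact: mulmx_pinv.
have hT x : (h (T x) < +oo)%E by exact: prox_grad_fin.
have CT x : C *m T x + d = 0 by exact: gbar_fin (hT x).
have dynE z : dynamics f g C d K L (1 / Lf) z =
    (T z.1 + Cp *m z.2, K *m z.2 + L *m (C *m z.1 + d)).
  case: z => x v; congr (_, _) => /=.
  rewrite /T /prox_grad -hcompat proj_affine//.
  by rewrite [in LHS]mulmxBr opprB [Cp *m v - _]addrC addrA.
pose e (z : 'cV[R]_n * 'cV[R]_m) := col_mx (C *m z.1 + d) z.2.
pose V := lyap Q; pose step := dynamics f g C d K L (1 / Lf).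
have Cstep z : C *m (step z).1 + d = z.2.
  by rewrite /step dynE /= mulmxDr CCp addrAC CT add0r.
have estep z : e (step z) = N *m e z.
  rewrite /N /e mul_block_col mul0mx add0r mul1mx Cstep /step dynE /=.
  by rewrite addrC.
have ystep z : y (step z).1 = T z.1 by rewrite /y Cstep /step dynE addrK.
have [c1 c1_gt0 V_le] := lyap_le Q.
have [c2 c2_gt0 V_ge] := lyap_ge Qsym Qpos.
have [cP cP_gt0 hcP] := mulmx_bounded Cp.
have [cC cC_gt0 hcC] := mulmx_bounded C.
have [cG cG_gt0 growth] :=
  quadratic_growth hf hLf hgrad h_proper h_lsc h_convex halpha hPL.
(* cp V bounds the cost of the displacement x - y x in E; beta is such that the
   decrease re beta V of the second term of W pays twice for it. *)
pose cp := (2 * Lf + 8 * Lf ^+ 2 / alpha) * (cP * c2).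
have /andP[a0 aL] := halpha.
have cp_gt0 : 0 < cp.
  by rewrite mulr_gt0 ?addr_gt0 ?divr_gt0 ?mulr_gt0 ?exprn_gt0.
pose beta := 2 * cp / re.
have beta_gt0 : 0 < beta by rewrite divr_gt0// mulr_gt0.
pose W (z : 'cV[R]_n * 'cV[R]_m) := E (y z.1) + beta * V (e z).
pose q := Num.max (1 - alpha / (2 * Lf)) (1 - re / 2).
have V0 z : 0 <= V z by exact: lyap_ge0.
have VN z : V (N *m z) <= (1 - re) * V z by exact: lyap_decay.
have He z : enorm (C *m z.1 + d) ^+ 2 + enorm z.2 ^+ 2 <= c2 * V (e z).
  by rewrite -sqr_enorm_col_mx.
pose D : set ('cV[R]_n * 'cV[R]_m) := [set z | (h (y z.1) < +oo)%E].
apply: (@lyapunov_exp_stable R n m _ _ D W q (2 * cG + (2 * cP + 1) * c2 / beta)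
  (2 * Lf + beta * (c1 * (cC + 1)))).
- by have [xs Fxs] := opt_set_nonempty hPL; exists (xs, 0).
- have aL2 : alpha / (2 * Lf) < 1 by rewrite ltr_pdivrMr ?mulr_gt0//; lra.
  have aL0 : 0 < alpha / (2 * Lf) by rewrite divr_gt0// mulr_gt0.
  rewrite /q lt_max gt_max; apply/andP.
  by split; [apply/orP; left|apply/andP; split]; lra.
- apply: addr_gt0; first exact: mulr_gt0.
  apply: divr_gt0 => //; apply: mulr_gt0 => //; apply: addr_gt0 => //.
  exact: mulr_gt0.
- apply: addr_gt0; first exact: mulr_gt0.
  by do 2!apply: mulr_gt0 => //; exact: addr_gt0.
- by move=> z; rewrite /D /= -/step ystep.
- move=> z Dz; rewrite -/step /W ystep estep.
  have := subopt_prox_grad_perturbed hf hLf hgrad h_proper h_lsc h_convex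
    halpha hPL z.1 Dz.
  rewrite -/(T _) -/E; have -> : z.1 - y z.1 = Cp *m (C *m z.1 + d).
    by rewrite /y subKr.
  set k := 2 * Lf + _; set u := C *m z.1 + d => ET.
  have k_ge0 : 0 <= k.
    by rewrite addr_ge0 ?mulr_ge0 ?divr_ge0 ?invr_ge0 ?exprn_ge0// ltW.
  have uV : k * enorm (Cp *m u) ^+ 2 <= cp * V (e z).
    rewrite /cp -/k -mulrA ler_wpM2l//; apply: le_trans (hcP u) _.
    rewrite -mulrA ler_wpM2l ?(ltW cP_gt0)//; apply: le_trans (He z).
    by rewrite lerDl sqr_ge0.
  have bV : beta * V (N *m e z) <= beta * ((1 - re) * V (e z)).
    by rewrite ler_wpM2l ?VN// ltW.
  have cpE : cp = beta * re / 2 by rewrite /beta; field; rewrite gt_eqF.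
  have q1 : (1 - alpha / (2 * Lf)) * E (y z.1) <= q * E (y z.1).
    by rewrite ler_wpM2r ?le_max ?lexx// (subopt_ge0 h_proper hPL Dz).
  have q2 : (1 - re / 2) * (beta * V (e z)) <= q * (beta * V (e z)).
    by rewrite ler_wpM2r ?le_max ?lexx ?orbT// mulr_ge0// ltW.
  rewrite mulrDr; apply: le_trans (lerD q1 q2).
  move: ET uV bV; rewrite cpE; lra.
- move=> z Dz; have [xs Fxs yxs] := growth _ Dz.
  exists (xs, 0) => //; rewrite /sqdist /= subr0.
  have -> : z.1 - xs = (y z.1 - xs) + Cp *m (C *m z.1 + d).
    by rewrite /y addrAC subrK.
  have E0 : 0 <= E (y z.1) by exact: (subopt_ge0 h_proper hPL Dz).
  have := sqr_enormD_le (y z.1 - xs) (Cp *m (C *m z.1 + d)).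
  have := hcP (C *m z.1 + d); have := He z.
  set eu := enorm (C *m z.1 + d) ^+ 2; set ev := enorm z.2 ^+ 2.
  have eu0 : 0 <= eu by exact: sqr_ge0.
  have ev0 : 0 <= ev by exact: sqr_ge0.
  move=> Hz Hu Hd.
  have k_ge0 : 0 <= 2 * cP + 1 by rewrite addr_ge0// mulr_ge0// ltW.
  have Hz' : (2 * cP + 1) * (eu + ev) <= (2 * cP + 1) * (c2 * V (e z)).
    by rewrite ler_wpM2l.
  have P1 : 0 <= cP * ev by rewrite mulr_ge0// ltW.
  have P2 : 0 <= cG * (beta * V (e z)).
    by rewrite mulr_ge0 ?(ltW cG_gt0)// mulr_ge0// ltW.
  have P3 : 0 <= (2 * cP + 1) * c2 / beta * E (y z.1).
    rewrite mulr_ge0// divr_ge0 ?(ltW beta_gt0)//.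
    by rewrite mulr_ge0// ltW.
  rewrite /W mulrDl mulrDr.
  have -> : (2 * cP + 1) * c2 / beta * (E (y z.1) + beta * V (e z)) =
     (2 * cP + 1) * c2 / beta * E (y z.1) + (2 * cP + 1) * (c2 * V (e z)).
    by field; rewrite gt_eqF.
  move: yxs Hd Hu P2 Hz' P1 P3; rewrite -/E; lra.
- move=> z [xs v] [Fxs /= ->]; rewrite -/step /W ystep estep /sqdist /= subr0.
  have ET := subopt_prox_grad_dist hf hLf hgrad h_proper h_lsc h_convex
    hPL z.1 Fxs.
  have [/gbar_fin Cxs _] := (opt_setP h_proper hPL xs).1 Fxs.
  have Ce : C *m z.1 + d = C *m (z.1 - xs).
    rewrite mulmxBr; congr (_ + _); apply/eqP.
    by rewrite -addr_eq0 addrC; apply/eqP; exact: Cxs.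
  have := V_le (e z); rewrite sqr_enorm_col_mx Ce; have := hcC (z.1 - xs).
  set dx := enorm (z.1 - xs) ^+ 2; set dv := enorm z.2 ^+ 2.
  have dx0 : 0 <= dx by exact: sqr_ge0.
  have dv0 : 0 <= dv by exact: sqr_ge0.
  move=> H1 H2.
  have H3 : V (N *m e z) <= V (e z).
    by apply: le_trans (VN _) _; rewrite ler_piMl// gerBl ltW.
  have H4 : V (N *m e z) <= c1 * (cC + 1) * (dx + dv).
    apply: le_trans H3 (le_trans H2 _); rewrite -mulrA ler_wpM2l ?(ltW c1_gt0)//.
    have : 0 <= cC * dv by rewrite mulr_ge0// ltW.
    by lra.
  have H5 : beta * V (N *m e z) <= beta * (c1 * (cC + 1)) * (dx + dv).
    by rewrite -mulrA ler_wpM2l// ltW.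
  have H6 : 0 <= 2 * Lf * dv by rewrite mulr_ge0// mulr_ge0// ltW.
  by move: ET; rewrite -/T -/E -/dx; lra.
Qed.
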